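(* Let $c>0$ be fixed and $s_n=n^{-1/2}$. For $\Delta_{L,n},\Delta_{U,n}>0$ and $\theta_n\in\mathbb R$ put $$\lambda_n=\frac{\Delta_{L,n}+\Delta_{U,n}}{2s_n},\qquad d_{L,n}=\frac{\theta_n+\Delta_{L,n}}{s_n},\qquad d_{U,n}=\frac{\Delta_{U,n}-\theta_n}{s_n},$$ $$P_M=\Phi(-c-d_{L,n})+\Phi(-c-d_{U,n}),\qquad P_N=\bigl[\Phi(d_{U,n}-c)-\Phi(c-d_{L,n})\bigr]_+,\qquad P_U=1-P_M-P_N.$$ (i) Suppose $\gamma_L\ne\gamma_U$. Under the rates $\Delta_{L,n}\asymp n^{-\gamma_L}$, $\Delta_{U,n}\asymp n^{-\gamma_U}$, the sequence $\lambda_n$ alone does not determine the limiting values of $(P_M,P_N,P_U)$, which depend separately on $d_{L,n}$ and $d_{U,n}$: there exist two choices of $(\Delta_{L,n},\Delta_{U,n},\theta_n)_n$ obeying these rates, with the same sequence $\lambda_n$, for which the limits of $(P_M,P_N,P_U)$ exist and differ. (ii) For example, let $\theta_n=0$, $\Delta_{L,n}=n^{-0.9}$, $\Delta_{U,n}=n^{-0.2}$ (so $\gamma_L=0.9$, $\gamma_U=0.2$). Then $\lambda_n\to\infty$, but $$d_{L,n}=n^{1/2-0.9}\to0,\qquad d_{U,n}=n^{1/2-0.2}\to\infty,$$ and consequently $$P_M\to\Phi(-c),\qquad P_N\to1-\Phi(c),\qquad P_U\to1-2\Phi(-c).$$ For $c=z_{1-\alpha/2}$ with $\alpha\in(0,1)$,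 these limits are $\alpha/2$, $\alpha/2$ and $1-\alpha$, respectively.
   Context: $\Phi$ is the standard normal distribution function, $z_{1-\alpha/2}$ its $(1-\alpha/2)$-quantile, $[x]_+=\max(x,0)$, and $x_n\asymp y_n$ means that $x_n/y_n$ is bounded away from $0$ and $\infty$. Interpretation: the relevance region is $[-\Delta_{L,n},\Delta_{U,n}]$; $d_{L,n}$ and $d_{U,n}$ are the standardized distances from $\theta_n$ to its two boundaries; $\lambda_n$ is the standardized half-width. With $\hat\theta_n\sim N(\theta_n,s_n^2)$ and $C_n=[\hat\theta_n-cs_n,\hat\theta_n+cs_n]$, $P_M$ is the probability that $C_n$ is disjoint from the region (''meaningfulness''), $P_N$ the probability that $C_n$ is contained in the region (''negligibility''), and $P_U$ the probability of neither (''unresolved''). *)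

(* Defs.v *)
(* MathComp-Analysis; the reals are an arbitrary [R : realType]. *)
From HB Require Import structures.
From mathcomp Require Export all_boot all_order all_algebra.
From mathcomp Require Export all_classical all_reals all_analysis.
Set Implicit Arguments.
Unset Strict Implicit.
Unset Printing Implicit Defensive.
Import Order.TTheory GRing.Theory Num.Theory.
Import numFieldNormedType.Exports.
Local Open Scope classical_set_scope.
Local Open Scope ring_scope.

(* Sequences are functions on [nat] whose relevant indices are n >= 1; the value
   at n = 0 (where [s_seq] vanishes) is junk and is never constrained. *)

Definition Phi {R : realType} (x : R) : R :=
  fine (normal_prob (0 : R) 1 `]-oo, x]).

Definition Phi_quantile {R : realType} (p : R) : R :=
  inf [set x : R | p <= Phi x].

Definition pospart {R : realType} (x : R) : R := Num.max x 0.

Definition asymp {R : realType} (x y : nat -> R) : Prop :=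
  exists a b : R, 0 < a /\ forall n : nat, (0 < n)%N -> a <= x n / y n <= b.

Definition s_seq {R : realType} (n : nat) : R := n%:R `^ (- (1 / 2)).

Definition lambda_seq {R : realType} (DL DU : nat -> R) (n : nat) : R :=
  (DL n + DU n) / (2 * s_seq n).

Definition dL_seq {R : realType} (DL theta : nat -> R) (n : nat) : R :=
  (theta n + DL n) / s_seq n.

Definition dU_seq {R : realType} (DU theta : nat -> R) (n : nat) : R :=
  (DU n - theta n) / s_seq n.

Definition P_M {R : realType} (c : R) (DL DU theta : nat -> R) (n : nat) : R :=
  Phi (- c - dL_seq DL theta n) + Phi (- c - dU_seq DU theta n).

Definition P_N {R : realType} (c : R) (DL DU theta : nat -> R) (n : nat) : R :=
  pospart (Phi (dU_seq DU theta n - c) - Phi (c - dL_seq DL theta n)).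

Definition P_U {R : realType} (c : R) (DL DU theta : nat -> R) (n : nat) : R :=
  1 - P_M c DL DU theta n - P_N c DL DU theta n.

Definition obeys_rates {R : realType} (gL gU : R) (DL DU : nat -> R) : Prop :=
  [/\ forall n : nat, (0 < n)%N -> 0 < DL n /\ 0 < DU n,
      asymp DL (fun n => n%:R `^ (- gL)) &
      asymp DU (fun n => n%:R `^ (- gU))].

Definition has_limits {R : realType} (c : R) (DL DU theta : nat -> R)
    (lM lN lU : R) : Prop :=
  [/\ P_M c DL DU theta n @[n --> \oo] --> lM,
      P_N c DL DU theta n @[n --> \oo] --> lN &
      P_U c DL DU theta n @[n --> \oo] --> lU].

(* Main.v *)
(* The sequence lambda_n involves only the two margins, so in (i) the two choices
   share the margins n^-gL, n^-gU and differ in theta_n. If theta_n exceeds the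
   upper boundary by 1, then d_L -> +oo, d_U -> -oo and P_M -> 1. If theta_n is
   the upper boundary itself, then d_U = 0 and d_L = 2 lambda_n >= 0, so P_M
   converges to a limit at most 2 Phi(-c) < 1. Part (ii) follows from the
   continuity of Phi, its limits at infinity and Phi(-c) = 1 - Phi(c); the
   quantile satisfies Phi(z_p) = p because Phi is continuous and increasing. *)
Require Import Defs.
From HB Require Import structures.
From mathcomp Require Import all_boot all_order all_algebra.
From mathcomp Require Import all_classical all_reals all_analysis.
From mathcomp Require Import measurable_realfun ring lra.
Set Implicit Arguments.
Unset Strict Implicit.
Unset Printing Implicit Defensive.
Import Order.TTheory GRing.Theory Num.Theory.
Import numFieldNormedType.Exports.
Local Open Scope classical_set_scope.
Local Open Scope ring_scope.

(** * The standard normal distribution function: monotonicity, continuity, symmetry, tails and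
    quantiles *)

Section StandardNormal.
Context {R : realType}.
Implicit Types x y : R.
Local Notation mu := (@lebesgue_measure R).
Local Notation pdf := (@normal_pdf R 0 1).

Lemma PhiE x : (Phi x)%:E = normal_prob 0 1 `]-oo, x].
Proof. by rewrite /Phi fineK// fin_num_measure. Qed.

Lemma PhiB x y : x <= y ->
  (Phi y - Phi x)%:E = (\int[mu]_(t in `]x, y]) (pdf t)%:E)%E.
Proof.
move=> xy; rewrite EFinB !PhiE.
rewrite (@itv_bndbnd_setU _ _ -oo%O (BRight x) (BRight y)) ?bnd_simp//.
rewrite measureU//=; last first.
  rewrite -subset0 => z/=; rewrite !in_itv/= => -[zx /andP[]].
  by rewrite ltNge zx.
by rewrite addeAC subee ?add0e// fin_num_measure.
Qed.

Lemma std_normal_pdf_antimono t m : `|t| <= m -> pdf m <= pdf t.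
Proof.
move=> tm; rewrite normal_pdfE ?oner_neq0//= ler_wpM2l ?normal_peak_ge0//.
rewrite ler_expR ler_wpM2r ?invr_ge0 ?mulrn_wge0 ?sqr_ge0// lerN2 !subr0.
by rewrite -(real_normK (num_real t)) lerXn2r ?nnegrE// (le_trans _ tm).
Qed.

Lemma std_normal_pdf_gt0 t : 0 < pdf t.
Proof.
rewrite normal_pdfE ?oner_neq0// mulr_gt0 ?expR_gt0//.
by rewrite normal_peak_gt0 ?oner_neq0.
Qed.

Lemma measurable_EFin_std_normal_pdf (A : set R) :
  measurable_fun A (fun t => (pdf t)%:E).
Proof.
apply/measurable_EFinP; apply: measurable_funTS.
exact: measurable_normal_pdf.
Qed.

(** With [m] the larger of the absolute values of the endpoints, the density is at least [pdf m > 0]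
    on the whole interval, so the increment is at least [pdf m * (y - x)]. *)
Lemma Phi_increasing x y : x < y -> Phi x < Phi y.
Proof.
move=> xy; rewrite -subr_gt0 -lte_fin PhiB; last exact: ltW.
pose m := Num.max `|x| `|y|.
apply: (@lt_le_trans _ _ (\int[mu]_(t in `]x, y]) (pdf m)%:E)%E).
  rewrite integral_cst//= lebesgue_measure_itv/= lte_fin xy -EFinB mule_gt0//.
    by rewrite lte_fin std_normal_pdf_gt0.
  by rewrite lte_fin subr_gt0.
apply: ge0_le_integral => //=.
- by move=> t _; rewrite lee_fin ltW// std_normal_pdf_gt0.
- exact: measurable_EFin_std_normal_pdf.
- move=> t; rewrite in_itv/= => /andP[xt ty].
  rewrite lee_fin std_normal_pdf_antimono//.
  have := ler_norm (- x); have := ler_norm y; rewrite normrN => yy xx.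
  have xm : `|x| <= m by rewrite le_max lexx.
  have ym : `|y| <= m by rewrite le_max lexx orbT.
  by rewrite ler_norml; apply/andP; split; lra.
Qed.

(** The density never exceeds its value [normal_peak 1] at the mean. Continuity of [Phi] follows
    from this bound. *)
Lemma Phi_lipschitz x y : x <= y -> Phi y - Phi x <= normal_peak 1 * (y - x).
Proof.
rewrite le_eqVlt => /predU1P[->|xy]; first by rewrite !subrr mulr0.
rewrite -lee_fin PhiB; last exact: ltW.
apply: (@le_trans _ _ (\int[mu]_(t in `]x, y]) (normal_peak (1 : R))%:E)%E).
  apply: ge0_le_integral => //=.
  - by move=> t _; rewrite lee_fin normal_pdf_ge0.
  - exact: measurable_EFin_std_normal_pdf.
  - by move=> t _; rewrite lee_fin normal_pdf_ub// oner_neq0.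
by rewrite integral_cst//= lebesgue_measure_itv/= lte_fin xy -EFinB EFinM.
Qed.

Lemma Phi_nondecreasing x y : x <= y -> Phi x <= Phi y.
Proof. by rewrite le_eqVlt => /predU1P[->//|/Phi_increasing/ltW]. Qed.

Lemma Phi_continuous : continuous (@Phi R).
Proof.
move=> x; apply/cvgrPdist_le => e e0.
have k0 : 0 < normal_peak (1 : R) by rewrite normal_peak_gt0 ?oner_neq0.
have d0 : 0 < e / normal_peak 1 by rewrite divr_gt0.
near=> y.
have : `|x - y| <= e / normal_peak 1.
  by near: y; exact: (@cvgr_dist_le _ _ _ _ _ id x).
rewrite ler_pdivlMr// mulrC; apply: le_trans.
have [xy|/ltW yx] := leP x y.
  rewrite distrC (distrC x) !ger0_norm ?subr_ge0 ?Phi_nondecreasing//.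
  exact: Phi_lipschitz.
by rewrite !ger0_norm ?subr_ge0 ?Phi_nondecreasing// Phi_lipschitz.
Unshelve. all: by end_near. Qed.

(** The density is even, so the substitution of [- t] for [t] turns the left tail at [- x] into the
    right tail at [x]; the two tails then differ only in the null endpoint. *)
Lemma PhiN x : Phi (- x) = 1 - Phi x.
Proof.
apply: EFin_inj; rewrite EFinB !PhiE -probability_setC// setCitvl.
rewrite /normal_prob ge0_integration_by_substitutionNy; last 2 first.
- apply: continuous_subspaceT.
  exact: (@continuous_normal_pdf R 0 1 (oner_neq0 _)).
- by move=> ? _; exact: normal_pdf_ge0.
have -> : pdf \o -%R = pdf.
  apply/funext => t /=.
  by rewrite normal_pdfE ?oner_neq0// /normal_fun !subr0 sqrrN.
by rewrite -integral_itv_obnd_cbnd//; exact: measurable_EFin_std_normal_pdf.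
Qed.

(** Under [normal_prob 0 1] the identity is a random variable whose cdf is [Phi], so the general
    limit of a cdf at [+oo] applies to [Phi]. *)
Let idR : measurableTypeR R -> R := idfun.

#[local] HB.instance Definition _ :=
  @isMeasurableFun.Build _ _ _ _ idR (@measurable_id _ _ setT).

Lemma Phi_cvgy : Phi x @[x --> +oo] --> (1 : R).
Proof.
pose P : probability _ R := @normal_prob R 0 1.
by have /fine_cvgP[] := cvg_cdfy1 (idR : {RV P >-> R}).
Qed.

Lemma Phi_cvgNy : Phi x @[x --> -oo] --> (0 : R).
Proof.
apply/cvgNy_compNP.
have -> : @Phi R \o -%R = (fun x => 1 - Phi x).
  by apply/funext => x; exact: PhiN.
have : 1 - Phi x @[x --> +oo] --> 1 - (1 : R).
  by apply: cvgB; [exact: cvg_cst|exact: Phi_cvgy].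
by rewrite subrr.
Qed.

Lemma Phi_itv x : 0 <= Phi x <= 1.
Proof. by rewrite -!lee_fin PhiE probability_le1// andbT. Qed.

(** This strict inequality separates the limits of [P_M] for the two choices of [theta]. *)
Lemma PhiN_lt2 x : 0 < x -> Phi (- x) + Phi (- x) < 1.
Proof.
move=> x0; have : Phi (- x) < Phi x by apply: Phi_increasing; lra.
rewrite PhiN; lra.
Qed.

Lemma Phi_quantileK (p : R) : 0 < p < 1 -> Phi (Phi_quantile p) = p.
Proof.
move=> /andP[p0 p1].
have [a pa] : exists a : R, Phi a <= p.
  by have [a pa] := filter_ex (cvgr_le _ Phi_cvgNy _ p0); exists a.
have [b pb] : exists b : R, p <= Phi b.
  by have [b pb] := filter_ex (cvgr_ge _ Phi_cvgy _ p1); exists b.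
have ab : a <= b.
  by rewrite leNgt; apply/negP => /Phi_increasing; rewrite ltNge (le_trans pa).
have [|q _ qp] := @IVT R Phi a b p ab (continuous_subspaceT Phi_continuous).
  by rewrite ge_min pa/= le_max pb orbT.
suff -> : Phi_quantile p = q by [].
(* Since [Phi] increases strictly and [Phi q = p], the set under the infimum is exactly the ray from
   [q]. *)
rewrite /Phi_quantile (_ : [set x | p <= Phi x] = `[q, +oo[%classic).
  by rewrite inf_itv.
apply/seteqP; split => x /=; rewrite in_itv/= andbT -qp;
  last exact: Phi_nondecreasing.
by rewrite !leNgt; apply: contra => /Phi_increasing.
Qed.

End StandardNormal.

(** * Limits of powers of [n] and of the three probabilities *)

Section MeaningfulnessLimits.
Context {R : realType}.
Implicit Types (a b c : R) (DL DU theta : nat -> R).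

(* Indices n >= 1 suffice: the sequences of the statement are junk at n = 0. *)
Lemma cvg_eq_pos (f g : nat -> R) (F : set_system R) :
  (forall n : nat, (0 < n)%N -> f n = g n) ->
  g n @[n --> \oo] --> F -> f n @[n --> \oo] --> F.
Proof.
move=> fg; apply: cvg_trans; apply: near_eq_cvg.
by near=> n; apply/esym/fg; near: n; exact: nbhs_infty_gt.
Unshelve. all: by end_near. Qed.

Lemma cvgy_natr_powR a : 0 < a -> (n%:R : R) `^ a @[n --> \oo] --> +oo.
Proof.
move=> a0; apply/cvgryPge => A; near=> n.
have [A0|A0] := leP A 0; first exact: le_trans (powR_ge0 _ _).
(* The power exceeds [A] as soon as [n] exceeds [A] to the power [1 / a]. *)
have -> : A = (A `^ a^-1) `^ a by rewrite -powRrM mulVf ?gt_eqF// powRr1// ltW.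
rewrite ge0_ler_powR ?nnegrE ?powR_ge0 ?(ltW a0)//.
by near: n; exact: nbhs_infty_ger.
Unshelve. all: by end_near. Qed.

Lemma cvg0_natr_powR a : a < 0 -> (n%:R : R) `^ a @[n --> \oo] --> 0.
Proof.
move=> a0; have a0' : 0 < - a by rewrite oppr_gt0.
apply: (cvg_eq_pos (g := fun n => (n%:R `^ (- a))^-1)) => [n _|].
  by rewrite powRN invrK.
apply/gtr0_cvgV0; last exact: cvgy_natr_powR.
by near=> n; rewrite powR_gt0// ltr0n; near: n; exact: nbhs_infty_gt.
Unshelve. all: by end_near. Qed.

Lemma is_cvg_natr_powR a : a <= 0 -> cvgn (fun n => (n%:R : R) `^ a).
Proof.
rewrite le_eqVlt => /predU1P[->|a0]; last exact: cvgP (cvg0_natr_powR a0).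
by under eq_fun do rewrite powRr0; exact: is_cvg_cst.
Qed.

Lemma natr_powR_div_s_seq a (n : nat) : (0 < n)%N ->
  n%:R `^ a / s_seq n = n%:R `^ (1 / 2 + a) :> R.
Proof.
move=> n0; rewrite /s_seq powRN invrK mulrC -powRD//.
by rewrite pnatr_eq0 -lt0n n0 implybT.
Qed.

(** The shift [theta] cancels in the sum of the two distances. *)
Lemma lambda_seqE DL DU theta (n : nat) :
  lambda_seq DL DU n = (dL_seq DL theta n + dU_seq DU theta n) / 2.
Proof.
rewrite /lambda_seq /dL_seq /dU_seq -mulrDl invfM mulrA mulrAC.
by congr (_ / _ / _); ring.
Qed.

Lemma obeys_rates_powR a b :
  obeys_rates a b (fun n => (n%:R : R) `^ (- a)) (fun n => n%:R `^ (- b)).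
Proof.
have n_gt0 e (n : nat) : (0 < n)%N -> 0 < (n%:R : R) `^ e.
  by move=> n0; rewrite powR_gt0// ltr0n.
by split=> [n n0| |]; [split; exact: n_gt0|exists 1, 1; split=> // n n0..];
  rewrite divff ?lexx// gt_eqF ?n_gt0.
Qed.

(** The hypotheses concern the values of [Phi] and not its arguments, so that finite and infinite
    distances are treated alike. *)
Lemma has_limitsP c DL DU theta (mL mU nL nU : R) :
    Phi (- c - dL_seq DL theta n) @[n --> \oo] --> mL ->
    Phi (- c - dU_seq DU theta n) @[n --> \oo] --> mU ->
    Phi (c - dL_seq DL theta n) @[n --> \oo] --> nL ->
    Phi (dU_seq DU theta n - c) @[n --> \oo] --> nU ->
  has_limits c DL DU theta (mL + mU) (pospart (nU - nL))
    (1 - (mL + mU) - pospart (nU - nL)).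
Proof.
move=> hmL hmU hnL hnU.
have hM : P_M c DL DU theta n @[n --> \oo] --> mL + mU by exact: cvgD.
have hN : P_N c DL DU theta n @[n --> \oo] --> pospart (nU - nL).
  apply: (continuous_cvg _ (h := @pospart R)); last exact: cvgB hnU hnL.
  exact: (@continuous_max R R idfun (cst 0) _ cvg_id (cvg_cst _)).
by split=> //; apply: cvgB => //; apply: cvgB => //; exact: cvg_cst.
Qed.

Lemma Phi_comp_cvg (u : nat -> R) l : u n @[n --> \oo] --> l ->
  Phi (u n) @[n --> \oo] --> Phi l.
Proof. by move=> ul; apply: (continuous_cvg _ _ ul); exact: Phi_continuous. Qed.

Lemma Phi_comp_cvgy (u : nat -> R) : u n @[n --> \oo] --> +oo ->
  Phi (u n) @[n --> \oo] --> (1 : R).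
Proof. by move=> uy; exact: cvg_comp uy Phi_cvgy. Qed.

Lemma Phi_comp_cvgNy (u : nat -> R) : u n @[n --> \oo] --> -oo ->
  Phi (u n) @[n --> \oo] --> (0 : R).
Proof. by move=> uy; exact: cvg_comp uy Phi_cvgNy. Qed.

Lemma cvgy_addl b (u : nat -> R) : u n @[n --> \oo] --> +oo ->
  b + u n @[n --> \oo] --> +oo.
Proof. by move=> uy; exact: cvg_comp uy (cvg_addrl b). Qed.

Lemma cvgNy_subl b (u : nat -> R) : u n @[n --> \oo] --> +oo ->
  b - u n @[n --> \oo] --> -oo.
Proof.
by move=> /cvgNrNy uy; apply: cvg_comp uy (cvg_addrl_Ny b).
Qed.

(** The exponents may have any sign. One positive exponent sends the argument to [-oo]; otherwise
    both powers converge and continuity of [Phi] applies. *)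
Lemma is_cvg_Phi_sub a b c :
  cvgn (fun n => Phi (c - ((n%:R : R) `^ a + n%:R `^ b))).
Proof.
have nn e (n : nat) : 0 <= (n%:R : R) `^ e by exact: powR_ge0.
have Nc (u : nat -> R) : u n @[n --> \oo] --> +oo -> cvgn (fun n => Phi (c - u n)).
  by move=> uy; apply: cvgP; apply: Phi_comp_cvgNy; exact: cvgNy_subl.
have [a0|a0] := ltP 0 a.
  apply: Nc; apply: ger_cvgy (cvgy_natr_powR a0).
  by apply: nearW => n; rewrite lerDl.
have [b0|b0] := ltP 0 b.
  apply: Nc; apply: ger_cvgy (cvgy_natr_powR b0).
  by apply: nearW => n; rewrite lerDr.
apply: cvgP; apply: Phi_comp_cvg; apply: cvgB; first exact: cvg_cst.
by apply: cvgD; exact: is_cvg_natr_powR.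
Qed.

(* Here [theta] lies above the region by 1, that is by [1 / s_seq n]
   standard errors. *)
Lemma has_limits_beyond c a b
    (DL := fun n => (n%:R : R) `^ a) (DU := fun n => (n%:R : R) `^ b) :
  has_limits c DL DU (fun n => DU n + 1) 1 0 0.
Proof.
have sy : (s_seq n)^-1 @[n --> \oo] --> (+oo : set_system R).
  apply: (cvg_eq_pos (g := fun n => n%:R `^ (1 / 2))); last exact: cvgy_natr_powR.
  by move=> n _; rewrite /s_seq powRN invrK.
have dLy : dL_seq DL (fun n => DU n + 1) n @[n --> \oo] --> +oo.
  (* The numerator of [dL_seq] is 1 plus two nonnegative margins. *)
  apply: ger_cvgy sy; near=> n.
  rewrite ler_peMl ?invr_ge0 ?powR_ge0//.
  by rewrite addrAC lerDr addr_ge0// powR_ge0.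
have dUE n : dU_seq DU (fun n => DU n + 1) n = - (s_seq n)^-1.
  by rewrite /dU_seq opprD addrA subrr sub0r mulN1r.
(* Only the second term of [P_M] survives, and both terms of [P_N] vanish. *)
have := @has_limitsP c DL DU (fun n => DU n + 1) 0 1 0 0.
rewrite /pospart subrr maxxx add0r subrr subr0; apply.
- exact/Phi_comp_cvgNy/cvgNy_subl.
- apply: Phi_comp_cvgy; under eq_fun do rewrite dUE opprK.
  exact: cvgy_addl.
- exact/Phi_comp_cvgNy/cvgNy_subl.
- apply: Phi_comp_cvgNy; under eq_fun do rewrite dUE addrC.
  exact: cvgNy_subl.
Unshelve. all: by end_near. Qed.

(* Here [theta] lies on the upper boundary, so that [dU_seq] vanishes. *)
Lemma has_limits_edge c a b
    (DL := fun n => (n%:R : R) `^ a) (DU := fun n => (n%:R : R) `^ b) :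
  exists lM lN lU, has_limits c DL DU DU lM lN lU /\ lM <= Phi (- c) + Phi (- c).
Proof.
have dLE (n : nat) : (0 < n)%N ->
    dL_seq DL DU n = n%:R `^ (1 / 2 + b) + n%:R `^ (1 / 2 + a).
  by move=> n0; rewrite /dL_seq mulrDl !natr_powR_div_s_seq.
have dUE n : dU_seq DU DU n = 0 by rewrite /dU_seq subrr mul0r.
have dL_cvg e : cvgn (fun n => Phi (e - dL_seq DL DU n)).
  have /cvg_ex[l el] := @is_cvg_Phi_sub (1 / 2 + b) (1 / 2 + a) e.
  by apply: cvgP; apply: cvg_eq_pos el => n n0; rewrite dLE.
have /cvg_ex[mL hmL] := dL_cvg (- c).
have /cvg_ex[nL hnL] := dL_cvg c.
do 3 eexists; split.
  apply: has_limitsP hmL _ hnL _.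
  - by apply: Phi_comp_cvg; under eq_fun do rewrite dUE subr0; exact: cvg_cst.
  - by apply: Phi_comp_cvg; under eq_fun do rewrite dUE sub0r; exact: cvg_cst.
(* The second term of [P_M] is constantly [Phi (- c)]; the first is at most that because [dL_seq] is
   nonnegative, and the bound passes to the limit. *)
rewrite lerD2r; apply: cvgr_to_le hmL _; near=> n.
apply: Phi_nondecreasing; rewrite gerBl dLE ?addr_ge0 ?powR_ge0//.
by near: n; exact: nbhs_infty_gt.
Unshelve. all: by end_near. Qed.

End MeaningfulnessLimits.

Theorem proposition4 (R : realType) (c : R) (hc : 0 < c) :
  (forall gL gU : R, gL <> gU ->
     exists DL DU theta DL' DU' theta' : nat -> R,
       [/\ obeys_rates gL gU DL DU,
           obeys_rates gL gU DL' DU',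
           forall n : nat, (0 < n)%N ->
             lambda_seq DL DU n = lambda_seq DL' DU' n &
           exists lM lN lU lM' lN' lU' : R,
             [/\ has_limits c DL DU theta lM lN lU,
                 has_limits c DL' DU' theta' lM' lN' lU' &
                 (lM, lN, lU) <> (lM', lN', lU')]])
  /\
  (let theta : nat -> R := fun _ => 0 in
   let DL : nat -> R := fun n => n%:R `^ (- (9 / 10)) in
   let DU : nat -> R := fun n => n%:R `^ (- (2 / 10)) in
   obeys_rates (9 / 10) (2 / 10) DL DU /\
   lambda_seq DL DU n @[n --> \oo] --> +oo /\
   (forall n : nat, (0 < n)%N ->
      dL_seq DL theta n = n%:R `^ (1 / 2 - 9 / 10)) /\
   dL_seq DL theta n @[n --> \oo] --> 0 /\
   (forall n : nat, (0 < n)%N ->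
      dU_seq DU theta n = n%:R `^ (1 / 2 - 2 / 10)) /\
   dU_seq DU theta n @[n --> \oo] --> +oo /\
   has_limits c DL DU theta (Phi (- c)) (1 - Phi c) (1 - 2 * Phi (- c)) /\
   (forall alpha : R, 0 < alpha < 1 -> c = Phi_quantile (1 - alpha / 2) ->
      has_limits c DL DU theta (alpha / 2) (alpha / 2) (1 - alpha))).
Proof.
split=> [gL gU _|theta DL DU].
  have [lM [lN [lU [hlim lM_le]]]] := has_limits_edge c (- gL) (- gU).
  do 6 eexists; split; [exact: obeys_rates_powR|exact: obeys_rates_powR|by []|].
  exists lM, lN, lU; do 3 eexists; split; [exact: hlim|exact: has_limits_beyond|].
  (* Equality of the limits would give [1 <= 2 * Phi (- c)]. *)
  by move=> [lM1 _ _]; move: lM_le; rewrite lM1 leNgt PhiN_lt2.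
have dLE (n : nat) : (0 < n)%N -> dL_seq DL theta n = n%:R `^ (1 / 2 - 9 / 10).
  by move=> n0; rewrite /dL_seq add0r natr_powR_div_s_seq.
have dUE (n : nat) : (0 < n)%N -> dU_seq DU theta n = n%:R `^ (1 / 2 - 2 / 10).
  by move=> n0; rewrite /dU_seq subr0 natr_powR_div_s_seq.
have dL0 : dL_seq DL theta n @[n --> \oo] --> 0.
  by apply: cvg_eq_pos dLE _; apply: cvg0_natr_powR; lra.
have dUy : dU_seq DU theta n @[n --> \oo] --> +oo.
  by apply: cvg_eq_pos dUE _; apply: cvgy_natr_powR; lra.
have lambda_y : lambda_seq DL DU n @[n --> \oo] --> +oo.
  (* As [dL_seq] is nonnegative here, half of [dU_seq] is a lower bound for [lambda_seq]. *)
  have : dU_seq DU theta n / 2 @[n --> \oo] --> +oo.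
    by apply: cvg_comp dUy (gt0_cvgMly _ cvg_id); rewrite invr_gt0.
  apply: ger_cvgy; near=> n; rewrite (lambda_seqE DL DU theta).
  by rewrite ler_wpM2r// lerDr mulr_ge0 ?addr_ge0 ?invr_ge0 ?powR_ge0.
have lim : has_limits c DL DU theta (Phi (- c)) (1 - Phi c) (1 - 2 * Phi (- c)).
  (* The lower distance tends to 0 and leaves [Phi (- c)] and [Phi c]; the upper one tends to [+oo]
     and leaves the tail values 0 and 1. *)
  have := @has_limitsP R c DL DU theta (Phi (- c)) 0 (Phi c) 1.
  have -> : pospart (1 - Phi c) = 1 - Phi c.
    by rewrite /pospart max_l// subr_ge0; case/andP: (Phi_itv c).
  have -> : 1 - (Phi (- c) + 0) - (1 - Phi c) = 1 - 2 * Phi (- c).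
    by rewrite PhiN; ring.
  rewrite addr0; apply.
  - apply: Phi_comp_cvg; rewrite -[X in _ --> X]subr0.
    by apply: cvgB => //; exact: cvg_cst.
  - exact/Phi_comp_cvgNy/cvgNy_subl.
  - apply: Phi_comp_cvg; rewrite -[X in _ --> X]subr0.
    by apply: cvgB => //; exact: cvg_cst.
  - apply: Phi_comp_cvgy; exact: cvg_comp dUy (cvg_addrr _).
split; first exact: obeys_rates_powR.
do 6 (split; first by []).
move=> alpha /andP[alpha0 alpha1] c_alpha.
have Phic : Phi c = 1 - alpha / 2.
  by rewrite c_alpha Phi_quantileK//; apply/andP; split; lra.
move: lim; rewrite PhiN Phic.
have -> : 1 - (1 - alpha / 2) = alpha / 2 by ring.
by have -> : 2 * (alpha / 2) = alpha by field.
Unshelve. all: by end_near. Qed.
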